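(* Let $p \in [1, \infty)$, let $G$ be a countable discrete group, and let $(G, A, \alpha)$ be an isometric $G$-$L^p$ operator algebra such that $A$ is separable and nondegenerately representable. For $g \in G$ let $E_g \colon F^p_{\mathrm r}(G, A, \alpha) \to A$ be the contractive linear map determined by $E_g\big( \sum_{h \in G} a_h u_h \big) = a_g$ for $\sum_{h} a_h u_h \in C_{\mathrm c}(G, A, \alpha)$. Then: (1) If $a \in F^p_{\mathrm r}(G, A, \alpha)$ and $E_g(a) = 0$ for all $g \in G$, then $a = 0$. (2) If $(X, \mathcal B, \mu)$ is a $\sigma$-finite measure space and $\pi_0 \colon A \to L(L^p(X, \mu))$ is a nondegenerate contractive representation such that the $L^p$ direct sum $\bigoplus_{g \in G} \pi_0 \circ \alpha_g$ is injective, then the regular representation $v\ltimes\pi$ of $F^p_{\mathrm r}(G, A, \alpha)$ associated to $\pi_0$ is injective.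
   Context: $L(E)$ is the algebra of bounded operators on a Banach space $E$. An $L^p$ operator algebra is a Banach algebra (not necessarily unital) isometrically isomorphic to a norm closed subalgebra of $L(L^p(X,\mu))$ for some measure space $(X,\mathcal B,\mu)$. A representation of $A$ on $L^p(X,\mu)$ is a continuous homomorphism $\pi\colon A\to L(L^p(X,\mu))$; it is contractive if $\|\pi(a)\|\le\|a\|$ for all $a$, isometric if $\|\pi(a)\|=\|a\|$ for all $a$, $\sigma$-finite if $\mu$ is $\sigma$-finite, and nondegenerate if the span of $\{\pi(a)\xi\}$ is dense. $A$ is nondegenerately representable if it has a nondegenerate isometric representation. The $L^p$ direct sum of contractive representations $\pi_j$ on $L^p(X_j,\mu_j)$ is the coordinatewise representation on the $l^p$-direct sum of the spaces $L^p(X_j,\mu_j)$ (which is $L^p$ of the disjoint union). An isometric $G$-$L^p$ operator algebra $(G,A,\alpha)$ ($G$ discrete) is an $L^p$ operator algebra $A$ with a homomorphism $\alpha$ from $G$ to the isometric automorphisms of $A$. $\nu$ is counting measure on $G$. Given a contractive representation $\pi_0\colon A\to L(L^p(X,\mu))$, the associated regular covariant representation $(v,\pi)$ acts on $L^p(G\times X,\nu\times\mu)=l^p(G,L^p(X,\mu))$ by $(v_g\xi)(h)=\xi(g^{-1}h)$ and $(\pi(a)\xi)(h)=\pi_0(\alpha_h^{-1}(a))(\xi(h))$. $C_{\mathrm c}(G,A,\alpha)$ is the algebra of finitely supported functions $G\to A$, written as finite sums $\sum_g a_gu_g$, with product determined by $(a u_g)(b u_h)=a\alpha_g(b)u_{gh}$;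 $(v\ltimes\pi)(\sum_g a_gu_g)=\sum_g\pi(a_g)v_g$. The reduced crossed product $F^p_{\mathrm r}(G,A,\alpha)$ is the Hausdorff completion of $C_{\mathrm c}(G,A,\alpha)$ in the seminorm $a\mapsto\sup\|(v\ltimes\pi)(a)\|$, over all regular covariant representations coming from nondegenerate $\sigma$-finite contractive representations $\pi_0$ of $A$ on $L^p$ spaces. For such $\pi_0$, the extension of $v\ltimes\pi$ to $F^p_{\mathrm r}(G,A,\alpha)$ is called the regular representation associated to $\pi_0$. The existence of the maps $E_g$ (well defined on $F^p_{\mathrm r}(G,A,\alpha)$, with $\|E_g\|\le1$) is a preceding result. *)

(* Defs.v *)
From HB Require Import structures.
From mathcomp Require Import all_boot all_order all_algebra.
From mathcomp Require Import complex generic_quotient ring_quotient.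
From mathcomp Require Import all_classical all_reals all_analysis.
From mathcomp Require Import measurable_realfun ring lra.

Set Implicit Arguments.
Unset Strict Implicit.
Unset Printing Implicit Defensive.

Import Order.TTheory GRing.Theory Num.Theory.
Import numFieldNormedType.Exports.

Local Open Scope classical_set_scope.
Local Open Scope ring_scope.
Local Open Scope complex_scope.

(* Banach algebras need not be unital here, so the multiplication is not that  *)
(* of a ring structure of the library.                                        *)
HB.mixin Record NormedModule_isNormedAlg (K : numFieldType) A
    & NormedModule K A := {
  amul : A -> A -> A ;
  amulA : associative amul ;
  amulDl : left_distributive amul +%R ;
  amulDr : right_distributive amul +%R ;
  amulZl : forall (k : K) (a b : A), amul (k *: a) b = k *: amul a b ;
  amulZr : forall (k : K) (a b : A), amul a (k *: b) = k *: amul a b ;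
  norm_amul : forall a b : A, `|amul a b| <= `|a| * `|b|
}.

#[short(type="normedAlgType")]
HB.structure Definition NormedAlg (K : numFieldType) :=
  {A of NormedModule K A & NormedModule_isNormedAlg K A}.

#[short(type="banachAlgType")]
HB.structure Definition BanachAlg (K : numFieldType) :=
  {A of NormedAlg K A & Complete A}.

(* The norm of a normed module over R[i] takes its values in R[i]; rnorm is   *)
(* the same norm with values in R (see rnormE).                               *)
Section rnorm.
Context {R : realType} {V : normedModType R[i]}.
Implicit Types x y : V.
Definition rnorm x : R := complex.Re `|x|.
Lemma rnormE x : (rnorm x)%:C = `|x|.
Proof.
have := normr_ge0 x; rewrite /rnorm; case: (`|x|) => a b.
by rewrite lecE /= => /andP[/eqP -> _].
Qed.
Lemma rnorm_ge0 x : 0 <= rnorm x.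
Proof. by rewrite -lecR rnormE; exact: normr_ge0. Qed.
Lemma rnormD x y : rnorm (x + y) <= rnorm x + rnorm y.
Proof. by rewrite -lecR rmorphD/= !rnormE ler_normD. Qed.
Lemma rnormZ (k : R[i]) x : rnorm (k *: x) = Normc.normc k * rnorm x.
Proof. 
apply: (fun (e : (rnorm (k *: x))%:C = (Normc.normc k * rnorm x)%:C) =>
  congr1 (@complex.Re R) e).
by rewrite rmorphM/= !rnormE normrZ.
Qed.
Lemma rnorm_eq0 x : rnorm x = 0 -> x = 0.
Proof. by move=> x0; apply/normr0_eq0; rewrite -rnormE x0. Qed.
Lemma rnorm0 : rnorm 0 = 0. Proof. by rewrite /rnorm normr0. Qed.
Lemma rnormN x : rnorm (- x) = rnorm x. Proof. by rewrite /rnorm normrN. Qed.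
End rnorm.

Lemma rnorm_le (R : realType) (V W : normedModType R[i]) (x : V) (y : W) :
  (rnorm x <= rnorm y) = (`|x| <= `|y|).
Proof. by rewrite -!rnormE lecR. Qed.

Section bounded_operators.
Context {R : realType} {E : normedModType R[i]}.

Definition bounded_op : {pred E -> E} :=
  [pred f | `[< linear f /\ continuous f >]].

Lemma bounded_opP (f : E -> E) : linear f ->
  (exists M : R, forall x, rnorm (f x) <= M * rnorm x) -> f \in bounded_op.
Proof.
move=> fl [M Mf]; rewrite inE; split=> //.
pose fL : {linear E -> E} := HB.pack f (GRing.isLinear.Build _ _ _ _ f fl).
apply: (@bounded_linear_continuous _ _ _ fL); apply/linear_boundedP.
near=> r => x; rewrite -!rnormE.
apply: (@le_trans _ _ (M%:C * (rnorm x)%:C)).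
  by rewrite -rmorphM lecR; exact: Mf.
apply: ler_wpM2r; first by rewrite rnormE.
by near: r; apply: nbhs_pinfty_ge; apply/complex_realP; exists M.
Unshelve. all: by end_near. Qed.

Lemma bounded_op_bound (f : E -> E) : f \in bounded_op ->
  exists2 M : R, 0 <= M & forall x, rnorm (f x) <= M * rnorm x.
Proof.
rewrite inE => -[fl fc].
pose fL : {linear E -> E} := HB.pack f (GRing.isLinear.Build _ _ _ _ f fl).
have /linear_boundedP /pinfty_ex_gt0[M M0 fM] :
  bounded_near fL (nbhs 0) by apply/linear_bounded_continuous.
have ME : M = (complex.Re M)%:C.
  by case: M M0 {fM} => a b; rewrite ltcE/= => /andP[/eqP ->].
exists (complex.Re M) => [|x]; first by rewrite -lecR -ME ltW.
by rewrite -lecR rmorphM/= !rnormE -ME; exact: fM.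
Qed.

Lemma bounded_op_submod : submod_closed bounded_op.
Proof.
split=> [|k f g fb gb].
  apply: bounded_opP => [k x y|]; first by rewrite scaler0 addr0.
  by exists 0 => x; rewrite rnorm0 mul0r.
have [M M0 fM] := bounded_op_bound fb; have [N N0 gN] := bounded_op_bound gb.
move: fb gb; rewrite !inE => -[fl _] [gl _].

suff : k *: f + g \in bounded_op by rewrite inE.
apply: bounded_opP => [a x y|].
  have fE z : (k *: f + g) z = k *: f z + g z by [].
  rewrite !fE fl gl !scalerDr !scalerA (mulrC a) -!addrA; congr (_ + _).
  by rewrite addrCA.
exists (Normc.normc k * M + N) => x.
apply: (le_trans (rnormD _ _)); rewrite mulrDl lerD//.
rewrite rnormZ -mulrA ler_wpM2l//.
by case: (k) => a b; exact: sqrtr_ge0.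
Qed.

HB.instance Definition _ :=
  GRing.isSubmodClosed.Build _ _ bounded_op bounded_op_submod.
End bounded_operators.

(* The algebra L(E), with the operator norm and composition as product.       *)
Record boundedOp (R : realType) (E : normedModType R[i]) :=
  BoundedOp { bop_fun :> E -> E ; bop_funP : bop_fun \in bounded_op }.

Section boundedOp_normedAlg.
Context {R : realType} {E : normedModType R[i]}.
Local Notation L := (boundedOp E).

HB.instance Definition _ := [isSub for @bop_fun R E].
HB.instance Definition _ := [Choice of L by <:].
HB.instance Definition _ := [SubChoice_isSubLmodule of L by <:].
Implicit Types S T : L.

Lemma bop_ext S T : (forall x, S x = T x) -> S = T.
Proof. by move=> ST; apply/val_inj/funext. Qed.

Lemma bop_linear T : linear T.
Proof. by have := bop_funP T; rewrite inE => -[]. Qed.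

Lemma bop0E x : (0 : L) x = 0. Proof. by []. Qed.
Lemma bopDE S T x : (S + T) x = S x + T x. Proof. by []. Qed.
Lemma bopZE k T x : (k *: T) x = k *: T x. Proof. by []. Qed.

Definition opnorm T : R := sup [set rnorm (T x) | x in [set x | rnorm x <= 1]].

Lemma opnorm_has_sup T :
  has_sup [set rnorm (T x) | x in [set x | rnorm x <= 1]].
Proof.
have [M M0 TM] := bounded_op_bound (bop_funP T); split.
  by exists (rnorm (T 0)), 0 => //=; rewrite rnorm0.
exists M => _ [x /= x1 <-]; apply: (le_trans (TM x)).
by rewrite -[leRHS]mulr1 ler_wpM2l.
Qed.

Lemma opnorm_ge0 T : 0 <= opnorm T.
Proof.
apply: (le_trans (rnorm_ge0 (T 0))); apply: sup_upper_bound.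
  exact: opnorm_has_sup.
by exists 0 => //=; rewrite rnorm0.
Qed.

Lemma opnormP T x : rnorm (T x) <= opnorm T * rnorm x.
Proof.
have T0 : T 0 = 0.
  by have := bop_linear T (-1) 0 0; rewrite scaler0 addr0 scaleN1r addNr.
have TZ k y : T (k *: y) = k *: T y.
  by have := bop_linear T k y 0; rewrite !addr0 T0 addr0.
have [x0|x0] := eqVneq (rnorm x) 0.
  by rewrite (rnorm_eq0 x0) T0 rnorm0 mulr0.
have xp : 0 < rnorm x by rewrite lt_def x0 rnorm_ge0.
have nxE : Normc.normc ((rnorm x)^-1)%:C = (rnorm x)^-1.
  by rewrite /= expr0n/= addr0 sqrtr_sqr ger0_norm// invr_ge0 ltW.
have : rnorm (T (((rnorm x)^-1)%:C *: x)) <= opnorm T.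
  apply: sup_upper_bound; first exact: opnorm_has_sup.
  exists (((rnorm x)^-1)%:C *: x) => //=.
  by rewrite rnormZ nxE mulVf.
by rewrite TZ rnormZ nxE mulrC ler_pdivrMr.
Qed.

Lemma opnorm_le T (M : R) : 0 <= M ->
  (forall x, rnorm (T x) <= M * rnorm x) -> opnorm T <= M.
Proof.
move=> M0 TM; apply: ge_sup; first exact: (opnorm_has_sup T).1.
move=> _ [x /= x1 <-]; apply: (le_trans (TM x)).
by rewrite -[leRHS]mulr1 ler_wpM2l.
Qed.

Lemma normc_ge0 (k : R[i]) : 0 <= Normc.normc k.
Proof. by case: k => a b; exact: sqrtr_ge0. Qed.

Lemma opnormD S T : (opnorm (S + T))%:C <= (opnorm S)%:C + (opnorm T)%:C.
Proof.
rewrite -rmorphD/= lecR; apply: opnorm_le => [|x].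
  by rewrite addr_ge0// opnorm_ge0.
by rewrite mulrDl; apply: (le_trans (rnormD _ _)); rewrite lerD// opnormP.
Qed.

Lemma opnormZ (k : R[i]) T : (opnorm (k *: T))%:C = `|k| * (opnorm T)%:C.
Proof.
have le (j : R[i]) (U : L) : opnorm (j *: U) <= Normc.normc j * opnorm U.
  apply: opnorm_le => [|x]; first by rewrite mulr_ge0 ?normc_ge0 ?opnorm_ge0.
  by rewrite bopZE rnormZ -mulrA ler_wpM2l ?normc_ge0 ?opnormP.
rewrite -[`|k|]/((Normc.normc k)%:C) -rmorphM/=; congr (_%:C).
apply/eqP; rewrite eq_le le/=.
have [->|k0] := eqVneq k 0.
  by rewrite Normc.normc0 mul0r opnorm_ge0.
have kp : 0 < Normc.normc k.
  rewrite lt_def normc_ge0 andbT; apply: contra k0 => /eqP/Normc.eq0_normc ->.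
  exact: eqxx.
rewrite -ler_pdivlMl// -Normc.normcV.
by have := le k^-1 (k *: T); rewrite scalerA mulVf// scale1r.
Qed.

Lemma opnorm_eq0 T : (opnorm T)%:C = 0 -> T = 0.
Proof.
case=> T0; apply: bop_ext => x; apply: rnorm_eq0; apply/eqP.
by rewrite eq_le rnorm_ge0 andbT (le_trans (opnormP T x))// T0 mul0r.
Qed.

HB.instance Definition _ := Lmodule_isNormed.Build R[i] L
  opnormD opnormZ opnorm_eq0.

Lemma bop_rnormE T : rnorm T = opnorm T. Proof. by []. Qed.

Lemma bop_comp_subproof S T : S \o T \in bounded_op.
Proof.
apply: bounded_opP => [k x y|]; first by rewrite /= !bop_linear.
exists (opnorm S * opnorm T) => x /=; apply: (le_trans (opnormP _ _)).
by rewrite -mulrA ler_wpM2l ?opnorm_ge0 ?opnormP.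
Qed.

Definition bop_comp S T : L := BoundedOp (bop_comp_subproof S T).

Lemma bop_compA : associative bop_comp.
Proof. by move=> S T U; exact: bop_ext. Qed.
Lemma bop_compDl : left_distributive bop_comp +%R.
Proof. by move=> S T U; exact: bop_ext. Qed.
Lemma bop_compDr : right_distributive bop_comp +%R.
Proof.
move=> S T U; apply: bop_ext => x.
by have := bop_linear S 1 (T x) (U x); rewrite !scale1r.
Qed.
Lemma bop_compZl (k : R[i]) S T : bop_comp (k *: S) T = k *: bop_comp S T.
Proof. exact: bop_ext. Qed.
Lemma bop_compZr (k : R[i]) S T : bop_comp S (k *: T) = k *: bop_comp S T.
Proof.
apply: bop_ext => x; have := bop_linear S k (T x) 0.
have := bop_linear S (-1) 0 0; rewrite scaler0 addr0 scaleN1r addNr => S0.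
by rewrite S0 !addr0.
Qed.
Lemma norm_bop_comp S T : `|bop_comp S T| <= `|S| * `|T|.
Proof.
rewrite -!rnormE -rmorphM/= lecR; apply: opnorm_le => [|x].
  by rewrite mulr_ge0 ?rnorm_ge0.
rewrite !bop_rnormE -mulrA; apply: (le_trans (opnormP S (T x))).
by rewrite ler_wpM2l ?opnorm_ge0 ?opnormP.
Qed.

HB.instance Definition _ := NormedModule_isNormedAlg.Build R[i] L
  bop_compA bop_compDl bop_compDr bop_compZl bop_compZr norm_bop_comp.

End boundedOp_normedAlg.

(* A complex function is measurable when its real and imaginary parts are.    *)
Section complex_Lp.
Context d (X : measurableType d) (R : realType).
Variables (mu : {measure set X -> \bar R}) (p : R).
Implicit Types f g : X -> R[i].

Definition Lp_norm f : \bar R := 'N[mu]_p%:E[EFin \o (fun x => Normc.normc (f x))]%E.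

Definition LpFun_pred (hp : 1 <= p) : {pred X -> R[i]} :=
  [pred f | `[< [/\ measurable_fun setT (@complex.Re R \o f),
                    measurable_fun setT (@complex.Im R \o f)
                  & (Lp_norm f < +oo)%E] >]].

Lemma measurable_normc f : measurable_fun setT (@complex.Re R \o f) ->
  measurable_fun setT (@complex.Im R \o f) ->
  measurable_fun setT (fun x => Normc.normc (f x)).
Proof.
move=> mr mi.
rewrite (_ : (fun x => _) =
  (fun x => ((complex.Re (f x)) ^+ 2 + (complex.Im (f x)) ^+ 2) `^ 2^-1)).
  apply: (measurableT_comp (measurable_powR _)).
  by apply: measurable_funD; apply: measurable_funX.
apply/funext => x; rewrite powR12_sqrt ?addr_ge0 ?sqr_ge0//.
by case: (f x).
Qed.

Hypothesis hp : 1 <= p.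
Let hpE : (1 <= p%:E)%E. Proof. by rewrite lee_fin. Qed.
Let p0 : 0 < p. Proof. exact: lt_le_trans hp. Qed.

Lemma le_Lnorm (u v : X -> R) : measurable_fun setT u -> measurable_fun setT v ->
  (forall x, 0 <= u x <= v x) ->
  ('N[mu]_p%:E[EFin \o u] <= 'N[mu]_p%:E[EFin \o v])%E.
Proof.
move=> mu' mv uv; rewrite unlock /Lnorm.
have int0 (w : X -> R) :
    ((\int[mu]_x `|(EFin \o w) x| `^ p)%E \in `[0%E, +oo%E]%O).
  rewrite in_itv/= leey andbT; apply: integral_ge0 => x _.
  by rewrite lee_fin powR_ge0.
apply: gt0_ler_poweR; [by rewrite invr_ge0 ltW|exact: int0|exact: int0|].
apply: ge0_le_integral => //=.
- apply/measurable_EFinP; apply: (@measurableT_comp _ _ _ _ _ _ (@powR R ^~ p)) => //.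
  exact: measurableT_comp.
- apply/measurable_EFinP; apply: (@measurableT_comp _ _ _ _ _ _ (@powR R ^~ p)) => //.
  exact: measurableT_comp.
- move=> x _; rewrite lee_fin ge0_ler_powR ?nnegrE ?(ltW p0)//.
  have /andP[u0 uvx] := uv x.
  by rewrite !ger0_norm// (le_trans u0).
Qed.

Lemma LpFun_predP f : f \in LpFun_pred hp <->
  [/\ measurable_fun setT (@complex.Re R \o f),
      measurable_fun setT (@complex.Im R \o f) & (Lp_norm f < +oo)%E].
Proof. by rewrite inE. Qed.

Lemma LpFun_normc f : f \in LpFun_pred hp ->
  (fun x => Normc.normc (f x)) \in Lfun mu p%:E.
Proof.
move=> /LpFun_predP[mr mi fin]; rewrite inE; apply/andP; split; rewrite inE//=.
exact: measurable_normc.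
Qed.

Lemma Lp_normZ (k : R[i]) f : f \in LpFun_pred hp ->
  Lp_norm (k *: f) = ((Normc.normc k)%:E * Lp_norm f)%E.
Proof.
move=> /LpFun_normc fL; have := LnormZ (Lfun_Sub hpE fL) (Normc.normc k).
rewrite ger0_norm ?normc_ge0// => <-; rewrite /Lp_norm; congr Lnorm.
apply/funext => x/=.
by rewrite -[(k *: f) x]/(k * f x) Normc.normcM.
Qed.

Lemma measurable_ReZD (k : R[i]) f g :
  f \in LpFun_pred hp -> g \in LpFun_pred hp ->
  measurable_fun setT (@complex.Re R \o (k *: f + g)) /\
  measurable_fun setT (@complex.Im R \o (k *: f + g)).
Proof.
move=> /LpFun_predP[fr fi _] /LpFun_predP[gr gi _].
split.
  rewrite (_ : _ \o _ = fun x =>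
    (complex.Re k * complex.Re (f x) - complex.Im k * complex.Im (f x))
    + complex.Re (g x)).
    apply: measurable_funD => //; apply: measurable_funB;
      exact: measurable_funM.
  apply/funext => x /=; rewrite -[(k *: f + g) x]/(k * f x + g x).
  by case: k => a b; case: (f x) => ? ?; case: (g x).
rewrite (_ : _ \o _ = fun x =>
  (complex.Re k * complex.Im (f x) + complex.Im k * complex.Re (f x))
  + complex.Im (g x)).
  apply: measurable_funD => //; apply: measurable_funD;
    exact: measurable_funM.
apply/funext => x /=; rewrite -[(k *: f + g) x]/(k * f x + g x).
by case: k => a b; case: (f x) => ? ?; case: (g x).
Qed.

Lemma normcD (x y : R[i]) :
  Normc.normc (x + y) <= Normc.normc x + Normc.normc y.
Proof. by have := ler_normD x y; rewrite -lecR rmorphD. Qed.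

Lemma Lp_normD f g : f \in LpFun_pred hp -> g \in LpFun_pred hp ->
  (Lp_norm (f + g)%R <= Lp_norm f + Lp_norm g)%E.
Proof.
move=> fL gL.
have [fr fi _] := (LpFun_predP f).1 fL; have [gr gi _] := (LpFun_predP g).1 gL.
have mf := measurable_normc fr fi; have mg := measurable_normc gr gi.
apply: le_trans (eminkowski _ mf mg hpE).
apply: le_Lnorm.
- have [] := measurable_ReZD 1 fL gL; rewrite scale1r; exact: measurable_normc.
- exact: measurable_funD.
- by move=> x; rewrite normc_ge0; exact: normcD.
Qed.

Lemma Lp_norm_cst0 : Lp_norm 0 = 0%E.
Proof.
rewrite /Lp_norm -[RHS](@Lnorm0 _ _ _ mu p%:E) ?gt_eqF ?lte_fin//.
by congr Lnorm; apply/funext => x; rewrite -[LHS]/((Normc.normc (0 : R[i]))%:E) Normc.normc0.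
Qed.

Lemma LpFun_submod : submod_closed (LpFun_pred hp).
Proof.
split.
  apply/LpFun_predP; split; try exact: measurable_cst.
  by rewrite Lp_norm_cst0.
move=> k f g fL gL; have [mr mi] := measurable_ReZD k fL gL.
have [_ _ ff] := (LpFun_predP f).1 fL.
have kf : k *: f \in LpFun_pred hp.
  have z0 : 0 \in LpFun_pred hp.
    apply/LpFun_predP; split; try exact: measurable_cst.
    by rewrite Lp_norm_cst0.
  have := measurable_ReZD k fL z0; rewrite addr0 => -[? ?].
  apply/LpFun_predP; split=> //.
  by rewrite Lp_normZ// lte_mul_pinfty ?lee_fin ?normc_ge0.
apply/LpFun_predP; split=> //; apply: (le_lt_trans (Lp_normD kf gL)).
by apply: lte_add_pinfty; have /LpFun_predP[] := kf; have /LpFun_predP[] := gL.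
Qed.

HB.instance Definition _ :=
  GRing.isSubmodClosed.Build _ _ (LpFun_pred hp) LpFun_submod.
End complex_Lp.

Record LpFun d (X : measurableType d) (R : realType)
    (mu : {measure set X -> \bar R}) (p : R) (hp : 1 <= p) :=
  MkLpFun { LpFun_fun :> X -> R[i] ; LpFunP : LpFun_fun \in LpFun_pred mu hp }.

Section Lp_space.
Context d (X : measurableType d) (R : realType).
Variables (mu : {measure set X -> \bar R}) (p : R) (hp : 1 <= p).
Local Notation L := (LpFun mu hp).

HB.instance Definition _ := [isSub for @LpFun_fun d X R mu p hp].
HB.instance Definition _ := [Choice of L by <:].
HB.instance Definition _ := [SubChoice_isSubLmodule of L by <:].

Definition ae_null : {pred L} := [pred f : L | `[< (f : X -> R[i]) = 0 %[ae mu] >]].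

Lemma ae_nullP (f : L) : f \in ae_null <-> (f : X -> R[i]) = 0 %[ae mu].
Proof. by rewrite inE. Qed.

Lemma ae_null_submod : submod_closed ae_null.
Proof.
split; first by apply/ae_nullP; apply: aeW.
move=> k f g /ae_nullP f0 /ae_nullP g0; apply/ae_nullP.
apply: filterS2 f0 g0 => x f0 g0 _.
rewrite -[LHS]/(k * (f : X -> R[i]) x + (g : X -> R[i]) x) f0// g0//.
by rewrite mulr0 addr0.
Qed.

HB.instance Definition _ :=
  GRing.isSubmodClosed.Build _ _ ae_null ae_null_submod.

(* The complex L^p space: p-integrable functions modulo a.e. equality.        *)
Definition Lp : Type := @Quotient.quot L (@ae_null : zmodClosed L).

HB.instance Definition _ := GRing.Zmodule.on Lp.

Definition Lp_class (f : L) : Lp := (\pi_(Quotient.quot _) f)%qT.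
Definition Lp_repr (x : Lp) : L := repr x.

Lemma Lp_reprK x : Lp_class (Lp_repr x) = x.
Proof. exact: reprK. Qed.

Lemma Lp_classD f g : Lp_class (f + g) = Lp_class f + Lp_class g.
Proof. by rewrite /Lp_class !piE. Qed.

Lemma Lp_classN f : Lp_class (- f) = - Lp_class f.
Proof. by rewrite /Lp_class !piE. Qed.

Lemma Lp_class0 : Lp_class 0 = 0.
Proof. by rewrite /Lp_class !piE. Qed.

Lemma Lp_classP f g :
  Lp_class f = Lp_class g <-> (f : X -> R[i]) = g %[ae mu].
Proof.
have e : (f = g %[ae mu]) <-> (f - g \in ae_null).
  split=> [fg|/ae_nullP fg].
    apply/ae_nullP; apply: filterS fg => x fg _.
    by rewrite -[LHS]/((f : X -> R[i]) x - (g : X -> R[i]) x) fg// subrr.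
  apply: filterS fg => x fg _; apply/eqP; rewrite -subr_eq0; apply/eqP.
  exact: fg.
by rewrite e Quotient.idealrBE; split=> [h|/eqP//]; apply/eqP; exact: h.
Qed.

Definition Lp_scale (k : R[i]) (x : Lp) : Lp := Lp_class (k *: Lp_repr x).

Lemma Lp_classZ (k : R[i]) f : Lp_class (k *: f) = Lp_scale k (Lp_class f).
Proof.
apply/Lp_classP; have /Lp_classP := Lp_reprK (Lp_class f).
apply: filterS => x fx _.
by rewrite -[RHS]/(k * (Lp_repr (Lp_class f) : X -> R[i]) x) fx.
Qed.

Lemma Lp_ind (P : Lp -> Prop) : (forall f, P (Lp_class f)) -> forall x, P x.
Proof. by move=> Pf x; rewrite -[x]Lp_reprK. Qed.

Lemma Lp_scaleA (a b : R[i]) x : Lp_scale a (Lp_scale b x) = Lp_scale (a * b) x.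
Proof. by elim/Lp_ind: x => f; rewrite -!Lp_classZ scalerA. Qed.

Lemma Lp_scale1 : left_id 1 Lp_scale.
Proof. by elim/Lp_ind => f; rewrite -Lp_classZ scale1r. Qed.

Lemma Lp_scaleDr : right_distributive Lp_scale +%R.
Proof.
move=> k; elim/Lp_ind => f; elim/Lp_ind => g.
by rewrite -Lp_classD -!Lp_classZ -Lp_classD scalerDr.
Qed.

Lemma Lp_scaleDl x : {morph Lp_scale^~ x : a b / a + b}.
Proof.
by move=> a b; elim/Lp_ind: x => f; rewrite -!Lp_classZ -Lp_classD scalerDl.
Qed.

HB.instance Definition _ := GRing.Zmodule_isLmodule.Build R[i] Lp
  Lp_scaleA Lp_scale1 Lp_scaleDr Lp_scaleDl.

Definition Lp_rnorm (x : Lp) : R := fine (Lp_norm mu p (Lp_repr x)).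

Lemma Lp_norm_fin (f : L) : Lp_norm mu p f \is a fin_num.
Proof.
have /LpFun_predP[_ _ h] := LpFunP f.
by rewrite ge0_fin_numE// Lnorm_ge0.
Qed.

Lemma Lp_norm_ae (f g : L) : (f : X -> R[i]) = g %[ae mu] ->
  Lp_norm mu p f = Lp_norm mu p g.
Proof.
move=> fg; rewrite /Lp_norm unlock /Lnorm; congr (_ `^ _)%E.
have mL (h : L) :
    measurable_fun setT (fun x => (`|(Normc.normc (h x))| `^ p)%:E).
  apply/measurable_EFinP; apply: (measurableT_comp (measurable_powR _)).
  apply: measurableT_comp => //; have /LpFun_predP[hr hi _] := LpFunP h.
  exact: measurable_normc.
apply: ae_eq_integral => //; [exact: mL|exact: mL|].
by apply: filterS fg => x fg _ /=; rewrite fg.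
Qed.

Lemma Lp_rnorm_class f : Lp_rnorm (Lp_class f) = fine (Lp_norm mu p f).
Proof.
by rewrite /Lp_rnorm; congr fine; apply/Lp_norm_ae/Lp_classP; rewrite Lp_reprK.
Qed.

Lemma Lp_rnorm_ge0 x : 0 <= Lp_rnorm x.
Proof. by apply: fine_ge0; exact: Lnorm_ge0. Qed.

Lemma Lp_rnormD x y :
  (Lp_rnorm (x + y))%:C <= (Lp_rnorm x)%:C + (Lp_rnorm y)%:C.
Proof.
elim/Lp_ind: x => f; elim/Lp_ind: y => g.
rewrite -rmorphD/= lecR -Lp_classD !Lp_rnorm_class -lee_fin EFinD.
rewrite !fineK ?Lp_norm_fin//; apply: (@Lp_normD _ _ _ mu p hp); exact: LpFunP.
Qed.

Lemma Lp_rnormZ (k : R[i]) x : (Lp_rnorm (k *: x))%:C = `|k| * (Lp_rnorm x)%:C.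
Proof.
elim/Lp_ind: x => f; rewrite -[`|k|]/((Normc.normc k)%:C) -rmorphM/=.
congr (_%:C); rewrite -[k *: _]/(Lp_scale k _) -Lp_classZ !Lp_rnorm_class.
have := Lp_normZ k (LpFunP f).
rewrite -[(k *: (f : X -> R[i]))]/((k *: f : L) : X -> R[i]) => ->.
by rewrite fineM ?Lp_norm_fin.
Qed.

Lemma Lp_rnorm_eq0 x : (Lp_rnorm x)%:C = 0 -> x = 0.
Proof.
elim/Lp_ind: x => f; case; rewrite Lp_rnorm_class -Lp_class0 => f0.
apply/Lp_classP.
have /LpFun_predP[fr fi _] := LpFunP f.
have : Lp_norm mu p f = 0%E by rewrite -(fineK (Lp_norm_fin f)) f0.
move=> /Lnorm_eq0_eq0.
have m : measurable_fun setT (EFin \o (fun x => Normc.normc (f x))).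
  by apply/measurable_EFinP; exact: measurable_normc.
move=> /(_ m (lt_le_trans lte01 _)) -/(_ hp).
by apply: filterS => x /(_ I) [] /Normc.eq0_normc ->.
Qed.

HB.instance Definition _ := Lmodule_isNormed.Build R[i] Lp
  Lp_rnormD Lp_rnormZ Lp_rnorm_eq0.

End Lp_space.

(* The l^p-direct sum l^p(I, E) of copies of E indexed by I. For E = Lp mu hp *)
(* it is L^p(I x X, nu x mu), nu being the counting measure on I.             *)
Section lp_direct_sum.
Context (I : choiceType) (R : realType) (E : normedModType R[i]).
Variable p : R.
Implicit Types f g : I -> E.

Definition lp_esum f : \bar R := \esum_(i in [set: I]) (rnorm (f i) `^ p)%:E.

Definition lp_pred (hp : 1 <= p) : {pred I -> E} :=
  [pred f | `[< (lp_esum f < +oo)%E >]].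

Hypothesis hp : 1 <= p.
Let p0 : 0 < p. Proof. exact: lt_le_trans hp. Qed.

Lemma lp_predP f : f \in lp_pred hp <-> (lp_esum f < +oo)%E.
Proof. by rewrite inE. Qed.

Lemma lp_esum_ge0 f : (0 <= lp_esum f)%E.
Proof. by apply: esum_ge0 => i _; rewrite lee_fin powR_ge0. Qed.

Lemma lp_esum_fin f : f \in lp_pred hp -> lp_esum f \is a fin_num.
Proof. by move=> /lp_predP h; rewrite ge0_fin_numE// lp_esum_ge0. Qed.

Lemma esumZ_le (c : R) (a : I -> R) : 0 <= c -> (forall i, 0 <= a i) ->
  (\esum_(i in [set: I]) (c * a i)%:E <= c%:E * \esum_(i in [set: I]) (a i)%:E)%E.
Proof.
move=> c0 a0; apply: ge_ereal_sup => _ [A [finA _] <-].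
under eq_fsbigr do rewrite EFinM.
rewrite -ge0_mule_fsumr; last by move=> i; rewrite lee_fin.
rewrite lee_wpmul2l ?lee_fin//; apply: esum_ge.
by exists A.
Qed.

Lemma lp_esum_term f i : ((rnorm (f i) `^ p)%:E <= lp_esum f)%E.
Proof.
apply: esum_ge; exists [set i]; first by split.
by rewrite fsbig_set1.
Qed.

Lemma lp_esum0_eq0 f : lp_esum f = 0%E -> f = 0.
Proof.
move=> f0; apply/funext => i; apply: rnorm_eq0.
have := lp_esum_term f i; rewrite f0 lee_fin => h.
have : rnorm (f i) `^ p = 0 by apply/eqP; rewrite eq_le h powR_ge0.
by move/powR_eq0_eq0.
Qed.

Lemma lp_esumZ_le (k : R[i]) f :
  (lp_esum (k *: f) <= (Normc.normc k `^ p)%:E * lp_esum f)%E.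
Proof.
have := @esumZ_le (Normc.normc k `^ p) (fun i => rnorm (f i) `^ p).
move=> /(_ (powR_ge0 _ _) (fun i => powR_ge0 _ _)); apply: le_trans.
apply: le_esum => i _; rewrite lee_fin -[(k *: f) i]/(k *: f i) rnormZ.
by rewrite powRM ?rnorm_ge0 ?normc_ge0.
Qed.

Lemma powR_convex2 (a b s t : R) : 0 <= a -> 0 <= b -> 0 < s -> 0 < t ->
  (a + b) `^ p <= (s + t) `^ p *
    (s / (s + t) * (a / s) `^ p + t / (s + t) * (b / t) `^ p).
Proof.
move=> a0 b0 s0 t0; have st : 0 < s + t by rewrite addr_gt0.
have l0 : 0 <= s / (s + t) by rewrite divr_ge0 ?ltW.
have l1 : s / (s + t) <= 1 by rewrite ler_pdivrMr// mul1r lerDl ltW.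
have lE : mathcomp.classical.unstable.onem (s / (s + t)) = t / (s + t).
  by rewrite -[LHS]/(1 - s / (s + t)); field; rewrite gt_eqF.
have := convex_powR hp (Itv01 l0 l1) (x := a / s) (y := b / t).
rewrite !inE/= !in_itv/= !andbT !divr_ge0 ?(ltW s0) ?(ltW t0)//.
move=> /(_ isT isT); rewrite !convRE/= lE => cvx.
rewrite [X in X `^ p](_ : _ = (s + t) *
  (s / (s + t) * (a / s) + t / (s + t) * (b / t))); last first.
  by field; rewrite !gt_eqF.
have ge0 : 0 <= s / (s + t) * (a / s) + t / (s + t) * (b / t).
  by rewrite addr_ge0 ?mulr_ge0 ?invr_ge0 ?(ltW s0) ?(ltW t0) ?(ltW st).
rewrite (powRM _ (ltW st) ge0) ler_wpM2l ?powR_ge0//.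
by move: cvx; rewrite [conv _ _ _]convRE/= lE.
Qed.

Definition lp_rnorm f : R := fine (lp_esum f) `^ p^-1.

Lemma lp_rnormK f : f \in lp_pred hp -> lp_esum f = (lp_rnorm f `^ p)%:E.
Proof.
move=> fp; rewrite /lp_rnorm -powRrM mulVf ?gt_eqF// powRr1 ?fine_ge0 ?lp_esum_ge0//.
by rewrite fineK// lp_esum_fin.
Qed.

Lemma lp_esumD_le f g : f \in lp_pred hp -> g \in lp_pred hp ->
  (lp_esum (f + g)%R <= ((lp_rnorm f + lp_rnorm g) `^ p)%:E)%E.
Proof.
move=> fp gp.
have z h : h \in lp_pred hp -> lp_rnorm h = 0 -> h = 0.
  move=> hP h0; apply: lp_esum0_eq0; rewrite lp_rnormK// h0 powR0//.
  by rewrite gt_eqF.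
have [f0|f0] := eqVneq (lp_rnorm f) 0.
  by rewrite f0 (z _ fp f0) !add0r -lp_rnormK.
have [g0|g0] := eqVneq (lp_rnorm g) 0.
  by rewrite g0 (z _ gp g0) !addr0 -lp_rnormK.
have s0 : 0 < lp_rnorm f by rewrite lt_def f0 powR_ge0.
have t0 : 0 < lp_rnorm g by rewrite lt_def g0 powR_ge0.
have := lp_rnormK fp; have := lp_rnormK gp.
move: s0 t0; move: (lp_rnorm f) (lp_rnorm g) {f0 g0} => s t s0 t0 tE sE.
pose c := (s + t) `^ p.
have c0 : 0 <= c by exact: powR_ge0.
have st : s + t != 0 by rewrite gt_eqF ?addr_gt0.
pose c1 := c * (s / (s + t)) * (s^-1) `^ p.
pose c2 := c * (t / (s + t)) * (t^-1) `^ p.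
have c10 : 0 <= c1.
  by rewrite !mulr_ge0 ?powR_ge0 ?invr_ge0 ?addr_ge0 ?(ltW s0) ?(ltW t0).
have c20 : 0 <= c2.
  by rewrite !mulr_ge0 ?powR_ge0 ?invr_ge0 ?addr_ge0 ?(ltW s0) ?(ltW t0).
have le1 : (lp_esum (f + g)%R <= c1%:E * lp_esum f + c2%:E * lp_esum g)%E.
  have pf i := powR_ge0 (rnorm (f i)) p; have pg i := powR_ge0 (rnorm (g i)) p.
  apply: le_trans (leeD (esumZ_le c10 pf) (esumZ_le c20 pg)).
  rewrite -esumD; [|by move=> i _; rewrite lee_fin mulr_ge0 ?powR_ge0..].
  apply: le_esum => i _; rewrite -EFinD lee_fin.
  have fg : rnorm ((f + g) i) `^ p <= (rnorm (f i) + rnorm (g i)) `^ p.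
    by rewrite ge0_ler_powR ?nnegrE ?(ltW p0) ?addr_ge0 ?rnorm_ge0// rnormD.
  apply: (le_trans fg).
  apply: (le_trans (powR_convex2 (rnorm_ge0 _) (rnorm_ge0 _) s0 t0)).
  rewrite !powRM ?rnorm_ge0 ?invr_ge0 ?(ltW s0) ?(ltW t0)//.
  rewrite le_eqVlt; apply/orP; left; apply/eqP.
  by rewrite /c1 /c2 /c; ring.
apply: (le_trans le1); rewrite sE tE -!EFinM -EFinD lee_fin.
have k (u : R) : 0 < u -> u^-1 `^ p * u `^ p = 1.
  by move=> u0; rewrite -powRM ?invr_ge0 ?(ltW u0)// mulVf ?gt_eqF// powR1.
rewrite /c1 /c2 -!(mulrA _ _ (_ `^ p)) !k// !mulr1 -mulrDr -mulrDl.
by rewrite divff// mulr1.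
Qed.

Lemma lp_submod : submod_closed (lp_pred hp).
Proof.
split.
  apply/lp_predP; rewrite /lp_esum esum1// => i _.
  by rewrite -[(0 : I -> E) i]/(0 : E) rnorm0 powR0// gt_eqF.
move=> k f g fp gp.
have kf : k *: f \in lp_pred hp.
  apply/lp_predP; apply: (le_lt_trans (lp_esumZ_le k f)).
  by rewrite lte_mul_pinfty ?lee_fin ?powR_ge0//; exact/lp_predP.
by apply/lp_predP; apply: (le_lt_trans (lp_esumD_le kf gp)); rewrite ltry.
Qed.

HB.instance Definition _ := GRing.isSubmodClosed.Build _ _ (lp_pred hp) lp_submod.
End lp_direct_sum.

Record lpSum (I : choiceType) (R : realType) (E : normedModType R[i])
    (p : R) (hp : 1 <= p) :=
  LpSum { lpSum_fun :> I -> E ; lpSumP : lpSum_fun \in lp_pred hp }.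

Section lpSum_normed.
Context (I : choiceType) (R : realType) (E : normedModType R[i]).
Variables (p : R) (hp : 1 <= p).
Local Notation L := (lpSum I E hp).
Let p0 : 0 < p. Proof. exact: lt_le_trans hp. Qed.

HB.instance Definition _ := [isSub for @lpSum_fun I R E p hp].
HB.instance Definition _ := [Choice of L by <:].
HB.instance Definition _ := [SubChoice_isSubLmodule of L by <:].
Implicit Types x y : L.

Lemma lpSum_ext x y : (forall i, x i = y i) -> x = y.
Proof. by move=> xy; apply/val_inj/funext. Qed.

Lemma powRpVp (u : R) : 0 <= u -> (u `^ p) `^ p^-1 = u.
Proof. by move=> u0; rewrite -powRrM mulfV ?gt_eqF// powRr1. Qed.

Lemma le_lp_rnorm (x : I -> E) (M : R) : 0 <= M ->
  (lp_esum p x <= (M `^ p)%:E)%E -> lp_rnorm p x <= M.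
Proof.
move=> M0 h; rewrite /lp_rnorm -[leRHS]powRpVp//.
have fin : lp_esum p x \is a fin_num.
  by rewrite ge0_fin_numE ?lp_esum_ge0// (le_lt_trans h) ?ltry.
rewrite ge0_ler_powR ?nnegrE ?powR_ge0 ?invr_ge0 ?(ltW p0) ?fine_ge0 ?lp_esum_ge0//.
by rewrite -lee_fin fineK.
Qed.

Lemma lpSum_normD x y :
  (lp_rnorm p (x + y)%R)%:C <= (lp_rnorm p x)%:C + (lp_rnorm p y)%:C.
Proof.
rewrite -rmorphD/= lecR; apply: le_lp_rnorm; first by rewrite addr_ge0 ?powR_ge0.
exact: lp_esumD_le (lpSumP x) (lpSumP y).
Qed.

Lemma lpSum_normZ (k : R[i]) x :
  (lp_rnorm p (k *: x))%:C = `|k| * (lp_rnorm p x)%:C.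
Proof.
have le (j : R[i]) y : lp_rnorm p (j *: y) <= Normc.normc j * lp_rnorm p y.
  apply: le_lp_rnorm; first by rewrite mulr_ge0 ?normc_ge0 ?powR_ge0.
  rewrite powRM ?normc_ge0 ?powR_ge0// EFinM -(lp_rnormK (lpSumP y)).
  exact: lp_esumZ_le.
rewrite -[`|k|]/((Normc.normc k)%:C) -rmorphM/=; congr (_%:C).
apply/eqP; rewrite eq_le le/=.
have [->|k0] := eqVneq k 0.
  by rewrite Normc.normc0 mul0r powR_ge0.
have kp : 0 < Normc.normc k.
  rewrite lt_def normc_ge0 andbT; apply: contra k0 => /eqP/Normc.eq0_normc ->.
  exact: eqxx.
rewrite -ler_pdivlMl// -Normc.normcV.
have kK : k^-1 *: (k *: x) = x by rewrite scalerA (mulVf k0) scale1r.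
by have := le k^-1 (k *: x); rewrite kK.
Qed.

Lemma lpSum_norm_eq0 x : (lp_rnorm p x)%:C = 0 -> x = 0.
Proof.
case=> x0; apply: val_inj; apply: (@lp_esum0_eq0 _ _ _ p).
by rewrite (lp_rnormK (lpSumP x)) x0 powR0// gt_eqF.
Qed.

HB.instance Definition _ := Lmodule_isNormed.Build R[i] L
  lpSum_normD lpSum_normZ lpSum_norm_eq0.

Lemma lpSum_rnormE x : rnorm x = lp_rnorm p x. Proof. by []. Qed.

End lpSum_normed.

Section representations.
Context {K : numFieldType}.

Record algHom (A B : normedAlgType K) := AlgHom {
  algHom_fun :> {linear A -> B} ;
  algHomM : forall a b, algHom_fun (amul a b) =
                        amul (algHom_fun a) (algHom_fun b) }.

Definition contractive (V W : normedModType K) (f : V -> W) : Prop :=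
  forall x, `|f x| <= `|x|.

Definition isometric (V W : normedModType K) (f : V -> W) : Prop :=
  forall x, `|f x| = `|x|.

Definition separable (V : topologicalType) : Prop :=
  exists2 S : set V, countable S & dense S.

Definition lspan (V : lmodType K) (S : set V) : set V :=
  [set y | exists (n : nat) (c : 'I_n -> K) (x : 'I_n -> V),
     (forall i, S (x i)) /\ y = \sum_i c i *: x i].

Lemma isometric_contractive (V W : normedModType K) (f : V -> W) :
  isometric f -> contractive f.
Proof. by move=> fi x; rewrite fi. Qed.

Lemma contractive_continuous (V W : normedModType K) (f : {linear V -> W}) :
  contractive f -> continuous f.
Proof.
move=> fc; apply: bounded_linear_continuous; apply/linear_boundedP.
near=> r => x; apply: (le_trans (fc x)); rewrite -[leLHS]mul1r.
by apply: ler_wpM2r.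
Unshelve. all: by end_near. Qed.

End representations.
Arguments lspan {K V}.

Record representation (R : realType) (A : normedAlgType R[i])
    (E : normedModType R[i]) := Representation {
  rep_hom :> algHom A (boundedOp E) ;
  rep_continuous : continuous rep_hom }.

Definition nondegenerate_rep (R : realType) (A : normedAlgType R[i])
    (E : normedModType R[i]) (pi : representation A E) : Prop :=
  dense (lspan [set y | exists a xi, y = pi a xi]).

Section Lp_algebras.
Context (R : realType) (p : R) (hp : 1 <= p) (A : banachAlgType R[i]).

Definition Lp_operator_algebra : Prop :=
  exists (d : measure_display) (X : measurableType d)
    (mu : {measure set X -> \bar R}) (pi : representation A (Lp mu hp)),
    isometric pi /\ closed (range pi).

Definition nondegenerately_representable : Prop :=
  exists (d : measure_display) (X : measurableType d)
    (mu : {measure set X -> \bar R}) (pi : representation A (Lp mu hp)),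
    isometric pi /\ nondegenerate_rep pi.
End Lp_algebras.

(* Homomorphisms from G to the isometric automorphisms of A; bijectivity of   *)
(* act g is a consequence of act1 and actM.                                   *)
Record isoAction (G : groupType) (K : numFieldType) (A : normedAlgType K) :=
  IsoAction {
    act :> G -> algHom A A ;
    act_isometric : forall g, isometric (act g) ;
    act1 : forall a, act 1%g a = a ;
    actM : forall g h a, act (g * h)%g a = act g (act h a) }.

(* The representation pi \o f, for an isometric homomorphism f.               *)
Section rep_comp.
Context (R : realType) (A B : normedAlgType R[i]) (E : normedModType R[i]).
Variables (pi : representation B E) (f : algHom A B).

Definition rep_comp_fun (a : A) : boundedOp E := pi (f a).

Lemma rep_comp_linear : linear rep_comp_fun.
Proof. by move=> k x y; rewrite /rep_comp_fun !linearP. Qed.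

HB.instance Definition _ :=
  GRing.isLinear.Build _ _ _ _ rep_comp_fun rep_comp_linear.

Lemma rep_comp_mul a b : rep_comp_fun (amul a b) =
  amul (rep_comp_fun a) (rep_comp_fun b).
Proof. by rewrite /rep_comp_fun !algHomM. Qed.

Hypothesis fi : isometric f.

Lemma rep_comp_continuous : continuous rep_comp_fun.
Proof.
move=> x; apply: continuous_comp; last exact: rep_continuous.
exact/contractive_continuous/isometric_contractive.
Qed.

Definition rep_comp : representation A E :=
  @Representation R A E (AlgHom rep_comp_mul) rep_comp_continuous.

Lemma rep_comp_contractive : contractive pi -> contractive rep_comp.
Proof. by move=> pc a; apply: (le_trans (pc _)); rewrite fi. Qed.
End rep_comp.

(* The L^p direct sum of a family of contractive representations on E:        *)
(* (direct_sum a x)(i) = pi i a (x i).                                        *)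
Section direct_sum.
Context (R : realType) (p : R) (hp : 1 <= p) (I : choiceType).
Context (A : normedAlgType R[i]) (E : normedModType R[i]).
Variables (pi : I -> representation A E).
Hypothesis pic : forall i, contractive (pi i).
Local Notation L := (lpSum I E hp).
Let p0 : 0 < p. Proof. exact: lt_le_trans hp. Qed.

Lemma direct_sum_esum (a : A) (x : L) :
  (lp_esum p (fun i => pi i a (x i)) <= ((rnorm a * rnorm x) `^ p)%:E)%E.
Proof.
rewrite powRM ?rnorm_ge0// EFinM -lp_rnormK; last exact: lpSumP.
have := @esumZ_le I R (rnorm a `^ p) (fun i => rnorm (x i) `^ p).
move=> /(_ (powR_ge0 _ _) (fun i => powR_ge0 _ _)); apply: le_trans.
apply: le_esum => i _; rewrite lee_fin -powRM ?rnorm_ge0//.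
rewrite ge0_ler_powR ?nnegrE ?(ltW p0) ?mulr_ge0 ?rnorm_ge0//.
apply: (le_trans (opnormP _ _)); rewrite ler_wpM2r ?rnorm_ge0//.
by have := pic i a; rewrite -rnorm_le.
Qed.

Lemma direct_sum_vec_subproof (a : A) (x : L) :
  (fun i => pi i a (x i)) \in lp_pred hp.
Proof.
by apply/lp_predP; apply: (le_lt_trans (direct_sum_esum a x)); rewrite ltry.
Qed.

Definition direct_sum_vec (a : A) (x : L) : L :=
  LpSum (direct_sum_vec_subproof a x).

Lemma direct_sum_vec_le a x :
  rnorm (direct_sum_vec a x) <= rnorm a * rnorm x.
Proof.
rewrite lpSum_rnormE; apply: (@le_lp_rnorm _ _ _ _ hp).
  by rewrite mulr_ge0 ?rnorm_ge0.
exact: direct_sum_esum.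
Qed.

Lemma direct_sum_op_subproof (a : A) : direct_sum_vec a \in bounded_op.
Proof.
apply: bounded_opP => [k x y|].
  by apply: lpSum_ext => i; rewrite /= (bop_linear (pi i a)).
by exists (rnorm a); exact: direct_sum_vec_le.
Qed.

Definition direct_sum_fun (a : A) : boundedOp L :=
  BoundedOp (direct_sum_op_subproof a).

Lemma direct_sum_linear : linear direct_sum_fun.
Proof.
by move=> k a b; apply: bop_ext => x; apply: lpSum_ext => i; rewrite /= linearP.
Qed.

HB.instance Definition _ :=
  GRing.isLinear.Build _ _ _ _ direct_sum_fun direct_sum_linear.

Lemma direct_sum_mul a b : direct_sum_fun (amul a b) =
  amul (direct_sum_fun a) (direct_sum_fun b).
Proof.
by apply: bop_ext => x; apply: lpSum_ext => i; rewrite /= algHomM.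
Qed.

Lemma direct_sum_contractive : contractive direct_sum_fun.
Proof.
move=> a; rewrite -rnorm_le; apply: opnorm_le; first exact: rnorm_ge0.
exact: direct_sum_vec_le.
Qed.

Definition direct_sum : representation A L :=
  @Representation R A L (AlgHom direct_sum_mul)
    (contractive_continuous direct_sum_contractive).

Lemma direct_sumE a x i : direct_sum a x i = pi i a (x i).
Proof. by []. Qed.
End direct_sum.

(* The operators v_g on l^p(G, E).                                            *)
Section translation.
Context (R : realType) (p : R) (hp : 1 <= p) (G : groupType).
Context (E : normedModType R[i]).
Local Notation L := (lpSum G E hp).

Lemma translation_esum (g : G) (x : G -> E) :
  lp_esum p (fun h => x (g^-1 * h)%g) = lp_esum p x.
Proof.
rewrite /lp_esum.
rewrite [RHS](@reindex_esum R G G setT setT (fun h => (g^-1 * h)%g))//.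
split=> //; first by move=> h k _ _ /mulgI.
by move=> h _; exists (g * h)%g => //; rewrite mulKg.
Qed.

Lemma translation_vec_subproof (g : G) (x : L) :
  (fun h => x (g^-1 * h)%g) \in lp_pred hp.
Proof. by apply/lp_predP; rewrite translation_esum; apply/lp_predP/lpSumP. Qed.

Definition translation_vec (g : G) (x : L) : L :=
  LpSum (translation_vec_subproof g x).

Lemma translation_op_subproof (g : G) : translation_vec g \in bounded_op.
Proof.
apply: bounded_opP => [k x y|]; first exact: lpSum_ext.
exists 1 => x; rewrite mul1r !lpSum_rnormE.
by rewrite /lp_rnorm translation_esum.
Qed.

Definition translation (g : G) : boundedOp L :=
  BoundedOp (translation_op_subproof g).

Lemma translationE g x h : translation g x h = x (g^-1 * h)%g.
Proof. by []. Qed.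
End translation.

(* Cc G A is C_c(G, A, alpha): the formal sum of the a_g u_g is the finitely  *)
(* supported function g |-> a_g.                                              *)
Section finitely_supported.
Context (G : groupType) (K : numFieldType) (A : normedAlgType K).

Definition finsupp_pred : {pred G -> A} :=
  [pred a | `[< finite_set [set g | a g != 0] >]].

Lemma finsupp_predP (a : G -> A) :
  a \in finsupp_pred <-> finite_set [set g | a g != 0].
Proof. by rewrite inE. Qed.

Lemma finsupp_submod : submod_closed finsupp_pred.
Proof.
split.
  apply/finsupp_predP; apply: sub_finite_set (finite_set0 _) => g /=.
  by rewrite eqxx.
move=> k a b /finsupp_predP fa /finsupp_predP fb; apply/finsupp_predP.
apply: sub_finite_set (_ : finite_set ([set g | a g != 0] `|` [set g | b g != 0])).
  move=> g /= abg; apply/orP; apply: contraNT abg.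
  rewrite negb_or !negbK => /andP[/eqP ag /eqP bg].
  by apply/eqP; rewrite -[LHS]/(k *: a g + b g) ag bg scaler0 addr0.
by rewrite finite_setU.
Qed.

HB.instance Definition _ :=
  GRing.isSubmodClosed.Build _ _ finsupp_pred finsupp_submod.
End finitely_supported.

Record Cc (G : groupType) (K : numFieldType) (A : normedAlgType K) :=
  MkCc { Cc_fun :> G -> A ; CcP : Cc_fun \in @finsupp_pred G K A }.

Section Cc_algebra.
Context (G : groupType) (K : numFieldType) (A : normedAlgType K).
Local Notation CcA := (Cc G A).

HB.instance Definition _ := [isSub for @Cc_fun G K A].
HB.instance Definition _ := [Choice of CcA by <:].
HB.instance Definition _ := [SubChoice_isSubLmodule of CcA by <:].

Variable alpha : isoAction G A.

(* The bilinear extension of (a u_g) (b u_h) = a alpha_g(b) u_gh; the sum is  *)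
(* over the finite support of a.                                              *)
Definition Cc_conv (a b : G -> A) (k : G) : A :=
  \sum_(g \in [set: G]) amul (a g) (alpha g (b (g^-1 * k)%g)).

Lemma amul0r (x : A) : amul 0 x = 0.
Proof. by have := amulZl 0 (0 : A) x; rewrite !scale0r. Qed.
Lemma amulr0 (x : A) : amul x 0 = 0.
Proof. by have := amulZr 0 x (0 : A); rewrite !scale0r. Qed.

Lemma Cc_mul_subproof (a b : CcA) : Cc_conv a b \in @finsupp_pred G K A.
Proof.
apply/finsupp_predP.
have fa := (finsupp_predP _).1 (CcP a); have fb := (finsupp_predP _).1 (CcP b).
have fab := finite_image2 (fun x y : G => (x * y)%g) fa fb.
apply: sub_finite_set fab => k /= k0.
have [g /= gk] : exists g, amul (a g) (alpha g (b (g^-1 * k)%g)) != 0.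
  apply: contrapT => h; move/negP: k0; apply; apply/eqP.
  rewrite /Cc_conv fsbig1// => g _; apply/eqP; apply: contrapT => /negP gk.
  by apply: h; exists g.
exists g; first by apply: contraNneq gk => ->; rewrite amul0r.
exists (g^-1 * k)%g; last by rewrite mulVKg.
by apply: contraNneq gk => ->; rewrite linear0 amulr0.
Qed.

Definition Cc_mul (a b : CcA) : CcA := MkCc (Cc_mul_subproof a b).
End Cc_algebra.

Section reduced_crossed_product.
Context (R : realType) (p : R) (hp : 1 <= p) (G : groupType).
Context (A : normedAlgType R[i]) (alpha : isoAction G A).

Section regular.
Context (E : normedModType R[i]) (pi0 : representation A E).
Hypothesis pi0c : contractive pi0.

Definition rep_act (g : G) : representation A E :=
  rep_comp pi0 (act_isometric alpha g).

Lemma rep_act_contractive (g : G) : contractive (rep_act g).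
Proof. exact: rep_comp_contractive. Qed.

(* The direct sum over g in G of the pi0 \o alpha_g.                          *)
Definition orbit_sum : representation A (lpSum G E hp) :=
  direct_sum hp rep_act_contractive.

(* (pi(a) xi)(h) = pi0 (alpha_h^-1 a) (xi h).                                 *)
Definition regular_pi : representation A (lpSum G E hp) :=
  direct_sum hp (fun h => rep_act_contractive h^-1%g).

(* v |x pi.                                                                   *)
Definition integrated_form (a : Cc G A) : boundedOp (lpSum G E hp) :=
  \sum_(g \in [set: G]) bop_comp (regular_pi (a g)) (translation hp E g).
End regular.

Definition reduced_seminorm (a : Cc G A) : \bar R :=
  ereal_sup [set r | exists (d : measure_display) (X : measurableType d)
    (mu : {sigma_finite_measure set X -> \bar R})
    (pi0 : representation A (Lp mu hp)) (pi0c : contractive pi0),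
    nondegenerate_rep pi0 /\ r = (rnorm (integrated_form pi0c a))%:E].

(* A Hausdorff completion of C_c(G, A, alpha) for the reduced seminorm: a     *)
(* complete algebra with a homomorphism from C_c(G, A, alpha) that has dense  *)
(* range and carries the norm back to the seminorm. This determines it up to  *)
(* a unique isometric isomorphism over C_c(G, A, alpha).                      *)
Record reducedCrossedProduct := ReducedCrossedProduct {
  rcp_alg :> banachAlgType R[i] ;
  rcp_incl : {linear Cc G A -> rcp_alg} ;
  rcp_inclM : forall a b,
    rcp_incl (Cc_mul alpha a b) = amul (rcp_incl a) (rcp_incl b) ;
  rcp_norm : forall a, (rnorm (rcp_incl a))%:E = reduced_seminorm a ;
  rcp_dense : dense (range rcp_incl) }.

(* By density of rcp_incl F these conditions determine the maps E_g.          *)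
Definition coefficient_maps (F : reducedCrossedProduct)
    (E : G -> {linear F -> A}) : Prop :=
  forall g, contractive (E g) /\ forall a, E g (rcp_incl F a) = a g.

(* rho is the continuous extension of v |x pi to F.                           *)
Definition regular_representation (F : reducedCrossedProduct)
    (E : normedModType R[i]) (pi0 : representation A E)
    (pi0c : contractive pi0) (rho : representation F (lpSum G E hp)) : Prop :=
  forall a, rho (rcp_incl F a) = integrated_form pi0c a.

End reduced_crossed_product.

(* Main.v *)
(* Identify an operator on l^p(G, V) with its matrix of entries. At (h, k), a
   regular representation sends a to pi0 (alpha_h^-1 (E_(h k^-1) a)); this is
   a computation on C_c(G, A, alpha), and both sides are continuous in a.
   (1) If all E_g a vanish and c in C_c is e-close to a, then a second element
   c' of C_c very close to a has very small coefficients, so on finitely many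
   coordinates the operator of c is that of c - c' up to a negligible error.
   Hence its norm is at most 2 e, for all regular representations at once, and
   |a| <= 3 e.
   (2) If rho a = 0, the entries with h k^-1 = g show that E_g a is killed by
   all pi0 \o alpha_h; so E_g a = 0 for all g, and (1) applies. *)

Require Import Defs.
From HB Require Import structures.
From mathcomp Require Import all_boot all_order all_algebra.
From mathcomp Require Import complex finmap.
From mathcomp Require Import all_classical all_reals all_analysis ring.

Set Implicit Arguments.
Unset Strict Implicit.
Unset Printing Implicit Defensive.

Import Order.TTheory GRing.Theory Num.Theory.
Import numFieldNormedType.Exports.

Local Open Scope classical_set_scope.
Local Open Scope ring_scope.
Local Open Scope complex_scope.

(** * Density, boundedness and finite sums in terms of the real-valued norm *)

Lemma dense_rnorm_approx (R : realType) (V : normedModType R[i]) (S : set V)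
    (a : V) (e : R) :
  dense S -> 0 < e -> exists2 b, S b & rnorm (a - b) < e.
Proof.
move=> Sd e0; have e0' : 0 < e%:C by rewrite ltcR.
have [|b [/interior_subset]] := Sd (ball a e%:C)° _ (open_interior _).
  by exists a; exact: nbhsx_ballx.
rewrite -ball_normE /ball_ /= => abe Sb; exists b => //.
by rewrite -ltcR rnormE.
Qed.

Lemma continuous_linear_rnorm_bound (R : realType) (V W : normedModType R[i])
    (f : {linear V -> W}) : continuous f ->
  exists2 M : R, 0 <= M & forall x, rnorm (f x) <= M * rnorm x.
Proof.
move=> fc; have /linear_boundedP /pinfty_ex_gt0[M M0 fM] :
  bounded_near f (nbhs 0) by apply/linear_bounded_continuous.
have ME : M = (complex.Re M)%:C.
  by case: M M0 {fM} => a b; rewrite ltcE/= => /andP[/eqP ->].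
exists (complex.Re M) => [|x]; first by rewrite -lecR -ME ltW.
by rewrite -lecR rmorphM/= !rnormE -ME; exact: fM.
Qed.

Lemma rnorm_sum (R : realType) (V : normedModType R[i]) (I : Type)
    (s : seq I) (f : I -> V) :
  rnorm (\sum_(i <- s) f i) <= \sum_(i <- s) rnorm (f i).
Proof.
elim: s => [|i s IH]; first by rewrite !big_nil rnorm0.
by rewrite !big_cons (le_trans (rnormD _ _))// lerD2l.
Qed.

(** * Coordinates and finite truncations in the l^p-direct sum *)

Section lpSum_coordinates.
Context (R : realType) (I : choiceType) (E : normedModType R[i]).
Context (p : R) (hp : 1 <= p).
Local Notation L := (lpSum I E hp).
Let p0 : 0 < p. Proof. exact: lt_le_trans hp. Qed.

Lemma lpSumDE (x y : L) i : (x + y) i = x i + y i. Proof. by []. Qed.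

Lemma lpSum_sumE (J : Type) (s : seq J) (f : J -> L) i :
  (\sum_(j <- s) f j) i = \sum_(j <- s) f j i.
Proof.
elim: s => [|j s IH]; first by rewrite !big_nil.
by rewrite !big_cons lpSumDE IH.
Qed.

Lemma le_rnorm_coord (x : L) i : rnorm (x i) <= rnorm x.
Proof.
have := lp_esum_term p x i; rewrite (lp_rnormK (lpSumP x)) lee_fin => xix.
rewrite -(powRpVp hp (rnorm_ge0 (x i))) -(powRpVp hp (rnorm_ge0 x)).
by rewrite ge0_ler_powR ?nnegrE ?powR_ge0 ?invr_ge0 ?(ltW p0).
Qed.

Lemma lp_restrict_esum (D : {fset I}) (x : I -> E) :
  (lp_esum p (fun i => if i \in D then x i else 0%R) <= lp_esum p x)%E.
Proof.
apply: le_esum => i _; rewrite lee_fin; case: ifP => // _.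
by rewrite rnorm0 powR0 ?powR_ge0// gt_eqF.
Qed.

Lemma lp_restrict_subproof (D : {fset I}) (x : L) :
  (fun i => if i \in D then x i else 0) \in lp_pred hp.
Proof.
apply/lp_predP; apply: (le_lt_trans (lp_restrict_esum D x)).
by apply/lp_predP/lpSumP.
Qed.

(** Truncations stay in the full direct sum, so that operators on it still apply to them. *)
Definition lp_restrict (D : {fset I}) (x : L) : L :=
  LpSum (lp_restrict_subproof D x).

Lemma lp_restrictD D (x y : L) :
  lp_restrict D (x + y) = lp_restrict D x + lp_restrict D y.
Proof.
by apply: lpSum_ext => i; rewrite lpSumDE /=; case: ifP => //; rewrite addr0.
Qed.

Lemma le_rnorm_restrict D (x : L) : rnorm (lp_restrict D x) <= rnorm x.
Proof.
rewrite lpSum_rnormE; apply: (@le_lp_rnorm _ _ _ _ hp); first exact: rnorm_ge0.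
by rewrite -(lp_rnormK (lpSumP x)); exact: lp_restrict_esum.
Qed.

(** The p-sum is a supremum of finite partial sums, each at most the p-th power of the norm of a
    truncation. Norm bounds can thus be checked on finitely many coordinates. *)
Lemma lpSum_rnorm_le_restrict (x : L) (M : R) : 0 <= M ->
  (forall D, rnorm (lp_restrict D x) <= M) -> rnorm x <= M.
Proof.
move=> M0 xM; rewrite lpSum_rnormE; apply: (@le_lp_rnorm _ _ _ _ hp) => //.
apply: ge_ereal_sup => _ [A [finA _] <-].
apply: (@le_trans _ _ (lp_esum p (lp_restrict (fset_set A) x))).
  apply: esum_ge; exists A; first by split.
  rewrite le_eqVlt; apply/orP; left; apply/eqP; apply: eq_fsbigr => i iA.
  by rewrite /= in_fset_set// iA.
rewrite (lp_rnormK (lpSumP (lp_restrict _ x))) lee_fin.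
by rewrite ge0_ler_powR ?nnegrE ?powR_ge0 ?(ltW p0)//; exact: xM.
Qed.

Lemma lp_single_esum (k : I) (v : E) :
  lp_esum p (fun i => if i == k then v else 0) = (rnorm v `^ p)%:E.
Proof.
rewrite -(@esum_set1 _ _ k (fun=> (rnorm v `^ p)%:E)) ?lee_fin ?powR_ge0//.
rewrite esum_mkcond; apply: eq_esum => i _; rewrite in_set1.
by case: ifP => // _; rewrite rnorm0 powR0// gt_eqF.
Qed.

Lemma lp_single_subproof (k : I) (v : E) :
  (fun i => if i == k then v else 0) \in lp_pred hp.
Proof. by apply/lp_predP; rewrite lp_single_esum ltry. Qed.

(** These vectors read off matrix entries: the entry of [T] at [(h, k)] sends [v] to
    [T (lp_single k v) h]. *)
Definition lp_single (k : I) (v : E) : L := LpSum (lp_single_subproof k v).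

Lemma rnorm_lp_single (k : I) (v : E) : rnorm (lp_single k v) = rnorm v.
Proof.
by rewrite lpSum_rnormE /lp_rnorm lp_single_esum/= powRpVp// rnorm_ge0.
Qed.

Lemma lp_restrict_single D (x : L) :
  lp_restrict D x = \sum_(i <- D) lp_single i (x i).
Proof.
apply: lpSum_ext => j; rewrite lpSum_sumE /=; case: ifP => jD.
  rewrite (big_fsetD1 j)//= eqxx big_seq big1 ?addr0// => i.
  by rewrite !inE => /andP[/negPf ij _]; rewrite eq_sym ij.
rewrite big_seq big1// => i iD; case: eqP => // ji.
by rewrite ji iD in jD.
Qed.

(** A crude triangle inequality; it suffices where [D] is fixed before the size of the coordinates
    is chosen. *)
Lemma rnorm_restrict_le_sum D (x : L) :
  rnorm (lp_restrict D x) <= \sum_(i <- D) rnorm (x i).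
Proof.
rewrite lp_restrict_single (le_trans (rnorm_sum _ _))//.
by apply: ler_sum => i _; rewrite rnorm_lp_single.
Qed.

End lpSum_coordinates.

(** * Additivity of bounded operators over finite sums *)

Section boundedOp_sums.
Context (R : realType) (V : normedModType R[i]).

Lemma bopB (T : boundedOp V) x y :
  T (x - y) = T x - T y.
Proof. by rewrite addrC -scaleN1r bop_linear scaleN1r addrC. Qed.

Lemma bop0 (T : boundedOp V) : T 0 = 0.
Proof. by have := bopB T 0 0; rewrite !subrr. Qed.

Lemma bop_sum (T : boundedOp V) (I : Type) (s : seq I)
    (f : I -> V) : T (\sum_(i <- s) f i) = \sum_(i <- s) T (f i).
Proof.
elim: s => [|i s IH]; first by rewrite !big_nil bop0.
rewrite !big_cons -IH; have := bop_linear T 1 (f i) (\sum_(j <- s) f j).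
by rewrite !scale1r.
Qed.

Lemma bop_sumE (I : Type) (s : seq I) (T : I -> boundedOp V) x :
  (\sum_(i <- s) T i) x = \sum_(i <- s) T i x.
Proof.
elim: s => [|i s IH]; first by rewrite !big_nil.
by rewrite !big_cons bopDE IH.
Qed.

End boundedOp_sums.

(** * Matrix entries of the integrated form on finitely supported functions *)

Section integrated_form.
Context (R : realType) (p : R) (hp : 1 <= p) (G : groupType).
Context (A : normedAlgType R[i]) (alpha : isoAction G A).
Context (E : normedModType R[i]) (pi0 : representation A E).
Hypothesis pi0c : contractive pi0.
Local Notation L := (lpSum G E hp).
Local Notation integ := (@integrated_form R p hp G A alpha E pi0 pi0c).

Lemma Cc_finite (c : Cc G A) : finite_set [set g | c g != 0].
Proof. exact/finsupp_predP/CcP. Qed.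

Definition Cc_supp (c : Cc G A) : {fset G} := fset_set [set g | c g != 0].

Lemma Cc_notin_supp (c : Cc G A) g : g \notin Cc_supp c -> c g = 0.
Proof.
rewrite in_fset_set; last exact: Cc_finite.
by rewrite notin_setE /= => /negP; rewrite negbK => /eqP.
Qed.

(** Any finite [S] containing the support is allowed, so that one set can serve several functions or
    receive an extra point. *)
Lemma integrated_formE (c : Cc G A) (S : {fset G}) (x : L) h :
  (forall g, g \notin S -> c g = 0) ->
  integ c x h = \sum_(g <- S) pi0 (alpha h^-1%g (c g)) (x (g^-1 * h)%g).
Proof.
move=> cS; rewrite /integrated_form (@fsbigTE _ _ _ _ S); last first.
  by move=> g /cS ->; rewrite linear0; apply: bop_ext.
by rewrite bop_sumE lpSum_sumE.
Qed.

Lemma rep_act_rnorm_le h a v :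
  rnorm (pi0 (alpha h a) v) <= rnorm a * rnorm v.
Proof.
apply: (le_trans (opnormP _ _)); rewrite ler_wpM2r ?rnorm_ge0//.
have : rnorm (pi0 (alpha h a)) <= rnorm (alpha h a) by rewrite rnorm_le.
by rewrite /(rnorm (alpha h a)) (act_isometric alpha).
Qed.

(** Only the [g] with [g^-1 * h = k] contributes, that is, [g = h * k^-1]. *)
Lemma integrated_form_single (c : Cc G A) k v h :
  integ c (lp_single hp k v) h = pi0 (alpha h^-1%g (c (h * k^-1)%g)) v.
Proof.
(* The point [h * k^-1] is adjoined so that its term can be split off even if [c] vanishes there. *)
have S0 g : g \notin ((h * k^-1)%g |` Cc_supp c)%fset -> c g = 0.
  by rewrite !inE negb_or => /andP[_]; exact: Cc_notin_supp.
rewrite (integrated_formE _ _ S0) (big_fsetD1 (h * k^-1)%g) ?fset1U1//=.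
rewrite invgM invgK -mulgA mulVg mulg1 eqxx big_seq big1 ?addr0// => g.
rewrite !inE => /andP[/eqP gk _]; case: eqP => [e|_]; last exact: bop0.
by case: gk; rewrite -e invgM invgK mulVKg.
Qed.

Lemma integrated_formB (b c : Cc G A) (x : L) :
  integ (b - c) x = integ b x - integ c x.
Proof.
pose S := (Cc_supp b `|` Cc_supp c)%fset.
have bS g : g \notin S -> b g = 0.
  by rewrite inE negb_or => /andP[/Cc_notin_supp].
have cS g : g \notin S -> c g = 0.
  by rewrite inE negb_or => /andP[_ /Cc_notin_supp].
have bcE g : (b - c) g = b g - c g by [].
apply: lpSum_ext => h; rewrite -[RHS]/(integ b x h - integ c x h).
rewrite !(@integrated_formE _ S)//; last first.
  by move=> g gS; rewrite bcE bS// cS// subrr.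
rewrite -sumrB; apply: eq_bigr => g _.
by rewrite bcE !linearB.
Qed.

(** Coordinate [h] of the image reads [x] only at the points [g^-1 * h] with [g] in the support of
    [c]. The set [K] does not depend on [x]. *)
Lemma integrated_form_restrict (c : Cc G A) (D : {fset G}) :
  exists K : {fset G}, forall x : L,
    lp_restrict D (integ c x) = lp_restrict D (integ c (lp_restrict K x)).
Proof.
exists [fset (g^-1 * h)%g | g in Cc_supp c, h in D]%fset => x.
apply: lpSum_ext => h /=; case: ifP => // hD.
rewrite !(integrated_formE _ _ (@Cc_notin_supp c)) big_seq [RHS]big_seq.
apply: eq_bigr => g gS /=; rewrite ifT//.
by apply/imfset2P; exists g => //; exists h.
Qed.

(** Row [h] meets [K] in [#|K|] entries, each of norm at most [d]. *)
Lemma integrated_form_coord_le (c : Cc G A) (d : R) (K : {fset G}) (x : L) h :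
  0 <= d -> (forall g, rnorm (c g) <= d) ->
  rnorm (integ c (lp_restrict K x) h) <= d * (#|` K|%:R * rnorm x).
Proof.
move=> d0 cd; rewrite lp_restrict_single bop_sum lpSum_sumE.
apply: (le_trans (rnorm_sum _ _)).
rewrite (_ : d * _ = \sum_(k <- K) d * rnorm x); last first.
  by rewrite big_const_seq count_predT iter_addr_0 mulrCA mulr_natl.
apply: ler_sum => k _; rewrite integrated_form_single.
apply: (le_trans (rep_act_rnorm_le _ _ _)).
by rewrite ler_pM ?rnorm_ge0// le_rnorm_coord.
Qed.

End integrated_form.

(** * Coefficients and regular representations on the completion *)

Section reduced_crossed_product.
Context (R : realType) (p : R) (hp : 1 <= p) (G : groupType).
Context (A : banachAlgType R[i]) (alpha : isoAction G A).
Context (F : reducedCrossedProduct hp alpha) (E : G -> {linear F -> A}).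
Hypothesis E_coef : coefficient_maps E.
Local Notation incl := (rcp_incl F).

Lemma rcp_approx (a : F) (e : R) : 0 < e ->
  exists c, rnorm (a - incl c) < e.
Proof.
move=> e0.
have [_ [c _ <-] ac] := dense_rnorm_approx a (@rcp_dense _ _ _ _ _ _ F) e0.
by exists c.
Qed.

Lemma coef_rnorm_le g (a : F) : rnorm (E g a) <= rnorm a.
Proof. by rewrite rnorm_le; have [Ec _] := E_coef g; exact: Ec. Qed.

Lemma coefE g c : E g (incl c) = c g.
Proof. by have [_ Ec] := E_coef g; exact: Ec. Qed.

Section nondegenerate.
Context d (X : measurableType d) (mu : {sigma_finite_measure set X -> \bar R}).
Context (pi0 : representation A (Lp mu hp)) (pi0c : contractive pi0).
Hypothesis pi0nd : nondegenerate_rep pi0.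
Local Notation integ := (integrated_form hp alpha pi0c).

(** Nondegeneracy of [pi0] puts this norm among those whose supremum is the reduced norm. *)
Lemma integrated_form_rnorm_le (c : Cc G A) : rnorm (integ c) <= rnorm (incl c).
Proof.
rewrite -lee_fin rcp_norm; apply: ereal_sup_ubound.
by exists d, X, mu, pi0, pi0c.
Qed.

(** The bound is the same for every [pi0], so it passes to the supremum. The order of choices is
    essential: [D], then [K], and only then [c'], whose error may therefore depend on both sets. *)
Lemma integrated_form_rnorm_small (a : F) (c : Cc G A) (e : R) :
  (forall g, E g a = 0) -> 0 < e -> rnorm (a - incl c) <= e ->
  rnorm (integ c) <= 2 * e.
Proof.
move=> Ea e0 ac; apply: opnorm_le => [|x]; first by rewrite mulr_ge0 ?ltW.
have e2x : 0 <= 2 * e * rnorm x by rewrite !mulr_ge0 ?rnorm_ge0 ?ltW.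
apply: lpSum_rnorm_le_restrict => // D.
have [K ->] := integrated_form_restrict hp alpha pi0c c D.
set y := lp_restrict K x.
(* With [t = e / N] the final error factor is [(e + t) + t * #|D| * #|K| = e + t * N = 2 * e]. *)
pose N : R := 1 + (#|` D| * #|` K|)%:R.
have N0 : 0 < N by rewrite ltr_wpDr.
have [c' ac'] := rcp_approx a (divr_gt0 e0 N0); set t := e / N in ac'.
have t0 : 0 < t by rewrite divr_gt0.
(* As [E g a = 0], the coefficient [c' g] is [E g (incl c' - a)], and [E g] is contractive. *)
have c't g : rnorm (c' g) <= t.
  rewrite -coefE -[E g _]subr0 -(Ea g) -linearB.
  rewrite (le_trans (coef_rnorm_le _ _))//.
  by rewrite -rnormN opprB ltW.
(* The first summand is controlled by the reduced norm, the second by its small entries on [D] and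
   [K]. *)
have -> : integ c y = integ (c - c') y + integ c' y.
  by rewrite integrated_formB subrK.
rewrite lp_restrictD; apply: (le_trans (rnormD _ _)).
have yx : rnorm y <= rnorm x by exact: le_rnorm_restrict.
have cc' : rnorm (incl (c - c')) <= e + t.
  rewrite (_ : incl _ = (a - incl c') - (a - incl c)); last first.
    by rewrite linearB opprB [RHS]addrC addrA subrK.
  by rewrite (le_trans (rnormD _ _))// rnormN addrC lerD// ltW.
have le1 : rnorm (lp_restrict D (integ (c - c') y)) <= (e + t) * rnorm x.
  apply: (le_trans (le_rnorm_restrict _ _)); apply: (le_trans (opnormP _ _)).
  apply: ler_pM; [exact: opnorm_ge0|exact: rnorm_ge0| |exact: yx].
  exact: le_trans (integrated_form_rnorm_le _) cc'.
have le2 : rnorm (lp_restrict D (integ c' y)) <=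
    t * (#|` D| * #|` K|)%:R * rnorm x.
  apply: (le_trans (rnorm_restrict_le_sum _ _)).
  rewrite (_ : _ * rnorm x =
    \sum_(h <- D) t * (#|` K|%:R * rnorm x)); last first.
    rewrite big_const_seq count_predT iter_addr_0 -[RHS]mulr_natl natrM.
    by rewrite [RHS]mulrCA !mulrA.
  by apply: ler_sum => h _; apply: integrated_form_coord_le => //; exact: ltW.
apply: (le_trans (lerD le1 le2)); rewrite -mulrDl ler_wpM2r ?rnorm_ge0//.
rewrite -addrA -{1}[t]mulr1 -mulrDr -/N /t divfK ?gt_eqF//.
by rewrite -[2]/(1 + 1) mulrDl mul1r.
Qed.

End nondegenerate.

Lemma coef_inj (a : F) : (forall g, E g a = 0) -> a = 0.
Proof.
move=> Ea; apply: rnorm_eq0; apply/eqP; rewrite eq_le rnorm_ge0 andbT.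
apply/ler_addgt0Pr => e e0; rewrite add0r.
(* A distance [e / 3] from [a] to [incl c] forces [rnorm (incl c) <= 2 * (e / 3)], which adds up to
   [e]. *)
have e30 : 0 < e / 3 by rewrite divr_gt0.
have [c ac] := rcp_approx a e30.
have c_le : rnorm (incl c) <= 2 * (e / 3).
  rewrite -lee_fin rcp_norm; apply: ge_ereal_sup => r.
  move=> [d [X [mu [pi0 [pi0c [pi0nd ->]]]]]]; rewrite lee_fin.
  exact: (integrated_form_rnorm_small pi0c pi0nd Ea e30 (ltW ac)).
rewrite -[a](subrK (incl c)); apply: (le_trans (rnormD _ _)).
rewrite (le_trans (lerD (ltW ac) c_le))// le_eqVlt; apply/orP; left.
by apply/eqP; field.
Qed.

(** Both sides are bounded linear in [a] and agree on the dense range of [incl] by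
    [integrated_form_single]. *)
Lemma regular_representation_single (V : normedModType R[i])
    (pi0 : representation A V) (pi0c : contractive pi0)
    (rho : representation F (lpSum G V hp)) (a : F) k v h :
  regular_representation pi0c rho ->
  rho a (lp_single hp k v) h = pi0 (alpha h^-1%g (E (h * k^-1)%g a)) v.
Proof.
move=> rho_reg; set x := lp_single hp k v.
have [M M0 rhoM] := continuous_linear_rnorm_bound (@rep_continuous _ _ _ rho).
apply/eqP; rewrite -subr_eq0; apply/eqP/rnorm_eq0/eqP.
rewrite eq_le rnorm_ge0 andbT; apply/ler_addgt0Pr => e e0; rewrite add0r.
(* The first term bounds the [rho] side, the second the [pi0] side, and the 1 makes [N] positive. *)
pose N := M * rnorm v + rnorm v + 1.
have N0 : 0 < N by rewrite ltr_wpDl ?addr_ge0 ?mulr_ge0 ?rnorm_ge0.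
have [c ac] := rcp_approx a (divr_gt0 e0 N0); set b := a - incl c in ac.
(* The two sides coincide at [incl c], so their difference is unchanged when [a] is replaced by
   [b]. *)
have -> : rho a x h - pi0 (alpha h^-1%g (E (h * k^-1)%g a)) v =
    rho b x h - pi0 (alpha h^-1%g (E (h * k^-1)%g b)) v.
  rewrite /b (linearB rho) (linearB (E _)) (linearB (alpha _)) (linearB pi0).
  rewrite rho_reg coefE -[RHS]/(rho a x h - integrated_form hp alpha pi0c c x h
    - (pi0 (alpha h^-1%g (E (h * k^-1)%g a)) v
       - pi0 (alpha h^-1%g (c (h * k^-1)%g)) v)).
  by rewrite integrated_form_single opprB addrA subrK.
apply: (le_trans (rnormD _ _)); rewrite rnormN.
have le1 : rnorm (rho b x h) <= M * rnorm b * rnorm v.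
  apply: (le_trans (le_rnorm_coord _ _)); apply: (le_trans (opnormP _ _)).
  by rewrite rnorm_lp_single ler_wpM2r ?rnorm_ge0//; exact: rhoM.
have le2 : rnorm (pi0 (alpha h^-1%g (E (h * k^-1)%g b)) v) <= rnorm b * rnorm v.
  apply: (le_trans (rep_act_rnorm_le alpha pi0c _ _ _)).
  by rewrite ler_wpM2r ?rnorm_ge0// coef_rnorm_le.
apply: (le_trans (lerD le1 le2)); apply: (@le_trans _ _ (rnorm b * N)).
  rewrite /N -subr_ge0 (_ : _ - _ = rnorm b); first exact: rnorm_ge0.
  by ring.
by rewrite -ler_pdivlMr// ltW.
Qed.

End reduced_crossed_product.

(** * Injectivity from the coefficients and from the orbit of [pi0] *)

Theorem proposition4p9 (R : realType) (p : R) (hp : 1 <= p)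
    (G : groupType) (A : banachAlgType R[i]) (alpha : isoAction G A)
    (F : reducedCrossedProduct hp alpha) (E : G -> {linear F -> A})
    (G_countable : countable [set: G])
    (A_Lp : Lp_operator_algebra hp A)
    (A_separable : separable A)
    (A_nondeg : nondegenerately_representable hp A)
    (E_coef : coefficient_maps E) :
  (forall a : F, (forall g : G, E g a = 0) -> a = 0) /\
  (forall (d : measure_display) (X : measurableType d)
      (mu : {sigma_finite_measure set X -> \bar R})
      (pi0 : representation A (Lp mu hp)) (pi0c : contractive pi0),
    nondegenerate_rep pi0 ->
    injective (orbit_sum hp alpha pi0c) ->
    forall rho : representation F (lpSum G (Lp mu hp) hp),
      regular_representation pi0c rho -> injective rho).
Proof.
split=> [a|d X mu pi0 pi0c pi0nd sum_inj rho rho_reg a b ab].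
  exact: coef_inj E_coef a.
apply/eqP; rewrite -subr_eq0; apply/eqP; apply: (coef_inj E_coef) => g.
(* It remains to see that each [pi0 (alpha h (E g (a - b)))] kills [x h]. *)
apply: sum_inj; rewrite linear0; apply: bop_ext => x; apply: lpSum_ext => h.
rewrite -[LHS]/(pi0 (alpha h (E g (a - b))) (x h)) bop0E.
(* The entry is taken in row [h^-1], since the regular representation twists row [k] by [alpha k^-1]
   while the orbit sum twists by [alpha h]. Column [g^-1 * h^-1] then makes the quotient of row and
   column equal to [g]. *)
have := regular_representation_single E_coef (a - b) (g^-1 * h^-1)%g
  (x h) h^-1%g rho_reg.
rewrite invgK invgM !invgK mulKg.
by rewrite (linearB rho) ab subrr bop0E => <-.
Qed.
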